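(* Let $m$ be a positive integer and let $G$ be a graph which is the union of pairwise edge-disjoint stars $S_1, \ldots, S_k$, with $e(G) = \binom{m+1}{2}$, such that $e(S_i) \ge \min\{1600 i, 20(m+1)\}$ for every $i \in [k]$. Then $G$ has an ascending subgraph decomposition into stars, i.e.\ there are pairwise edge-disjoint subgraphs $H_1, \ldots, H_m$ of $G$ covering all edges of $G$ such that each $H_i$ is a star with exactly $i$ edges.
   Context: A star of size $s$ is the graph $K_{1,s}$ (one centre joined to $s$ leaves); its size is its number of edges. $e(H)$ denotes the number of edges of $H$. The stars $S_1,\dots,S_k$ are only required to be edge-disjoint (they may share vertices). *)

(* Defs.v *)
From mathcomp Require Import all_boot.
Set Implicit Arguments.
Unset Strict Implicit.
Unset Printing Implicit Defensive.

(* Finite simple graphs carry their own vertex set inside an ambient finite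
   type, so that unions and subgraphs are taken within one type; an edge is a
   two-element set of vertices. *)
Record sgraph (T : finType) := SGraph {
  vset : {set T};
  eset : {set {set T}};
  edgeP : forall A : {set T}, A \in eset -> #|A| = 2 /\ A \subset vset }.

Definition nb_edges (T : finType) (G : sgraph T) : nat := #|eset G|.

Definition subgraph (T : finType) (H G : sgraph T) : Prop :=
  vset H \subset vset G /\ eset H \subset eset G.

(* A copy of K_{1,s}: the set L of leaves has s elements, which is also the
   number of edges. *)
Definition is_star (T : finType) (H : sgraph T) : Prop :=
  exists (c : T) (L : {set T}),
    [/\ c \notin L, vset H = c |: L & eset H = [set [set c; x] | x in L]].

(* Vertices may be shared. *)
Definition edge_disjoint (T : finType) (k : nat) (F : 'I_k -> sgraph T) : Prop :=
  forall i j : 'I_k, i != j -> [disjoint eset (F i) & eset (F j)].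

Definition is_union (T : finType) (k : nat) (G : sgraph T)
    (F : 'I_k -> sgraph T) : Prop :=
  vset G = \bigcup_(i < k) vset (F i) /\ eset G = \bigcup_(i < k) eset (F i).

(* 'I_m starts at 0, hence the shift: F i is the (i+1)-st star. *)
Definition ascending_star_decomposition (T : finType) (m : nat) (G : sgraph T)
    (F : 'I_m -> sgraph T) : Prop :=
  [/\ forall i : 'I_m, subgraph (F i) G,
      edge_disjoint F,
      eset G = \bigcup_(i < m) eset (F i)
    & forall i : 'I_m, is_star (F i) /\ nb_edges (F i) = i.+1].

(* Main.v *)
Require Import Defs.
From mathcomp Require Import all_boot.
From mathcomp Require Import zify.
Set Implicit Arguments.
Unset Strict Implicit.
Unset Printing Implicit Defensive.

(* It suffices to partition {1, ..., m} into sets whose sums are the sizes of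
   the given stars. Write N = m + 1 and pair x with N - x. A star of size a
   takes two fresh numbers (none if N divides a) whose sum is at most a and
   congruent to a mod N, so that what it still misses is a number of complete
   pairs; the partners of the two numbers go to a pool, which initially holds
   N / 2 if N is even. The stars of size less than 20 N come first, in the
   order of their indices: the i-th one has size at least 1600 i, hence more
   choices than there are numbers already touched. The other stars also absorb
   about a / N pool elements each before choosing their fresh numbers, and
   their total size is large enough for the last one to absorb all of the
   pool. The untouched numbers now form complete pairs of sum N, which are
   distributed freely. *)

(** Induction on [#|L|]: a removed element goes to some [i] with [0 < n i], and that quota drops by
    one. This later hands out complete pairs to targets and leaves to the new stars; [i0] only
    serves as a value of [g] when [L] is empty. *)
Lemma split_card (T I : finType) (i0 : I) (L : {set T}) (n : I -> nat) :
  \sum_i n i = #|L| -> exists g : T -> I,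
  forall i, #|[set x in L | g x == i]| = n i.
Proof.
elim: {L}_.+1 {-2}L (ltnSn #|L|) n => // N IHN L; rewrite ltnS => leLN n sum_n.
have [L0|[x xL]] := set_0Vmem L.
  exists (fun=> i0) => i.
  rewrite L0 cards0 in sum_n; move/eqP: sum_n; rewrite sum_nat_eq0 => /forallP.
  move=> /(_ i) /eqP ->; apply/eqP; rewrite cards_eq0; apply/eqP/setP => y.
  by rewrite L0 !inE.
have cardL := cardsD1 x L; rewrite xL add1n in cardL.
have /existsP[i ni] : [exists i, 0 < n i].
  apply: contraPT sum_n; rewrite negb_exists => /forallP n0; rewrite cardL big1 // => i _.
  by move: (n0 i); rewrite -eqn0Ngt => /eqP.
have sumD : \sum_j (n j - (j == i)) = #|L :\ x|.
  move: sum_n; rewrite cardL (bigD1 i) //= => sum_n.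
  rewrite (bigD1 i) //= eqxx (eq_bigr n); first by lia.
  by move=> j /negPf->; rewrite subn0.
have [|g gP] := IHN (L :\ x) _ _ sumD; first by rewrite -ltnS -cardL.
exists (fun y => if y == x then i else g y) => j.
have -> : [set y in L | (if y == x then i else g y) == j]
   = (if i == j then [set x] else set0) :|: [set y in L :\ x | g y == j].
  apply/setP => y; case: (eqVneq i j) => [<-|nij]; rewrite !inE;
    by case: (y =P x) => [->|_]; rewrite ?xL ?eqxx ?(negPf nij) ?andbF.
case: eqVneq => [<-|nij].
  by rewrite cardsU1 !inE eqxx /= gP eqxx addnC subnK.
by rewrite set0U gP eq_sym (negPf nij) subn0.
Qed.

(** * The numbers 1 to m under the mirror symmetry, the ordinal [x] standing for [x.+1] *)

Section Symmetric.
Variable m : nat.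
Implicit Types (x y : 'I_m) (F E : {set 'I_m}).
Local Notation mirror := (@rev_ord m).

Lemma addSrev x : x.+1 + (mirror x).+1 = m.+1.
Proof. by have := ltn_ord x; rewrite /=; lia. Qed.

(** Let [r] be the nonzero residue of [a]. A candidate [z] determines its partner modulo [m.+1] by
    their sum being [r]. Each touched number spoils at most two candidates and three more are
    degenerate, so at most [2 * #|F| + 3] of the [minn a.-1 m] candidates fail. *)
Lemma fresh_set F a : (forall x, mirror x = x -> x \in F) ->
  2 * #|F| + 3 < m -> 2 * #|F| + 4 < a ->
  exists2 E : {set 'I_m},
    [/\ #|E| <= 2, [disjoint E & F] & [disjoint E & mirror @: E]]
    & exists n, a = \sum_(x in E) x.+1 + n * m.+1.
Proof.
move=> fixF Fm Fa.
have [q [r [ar rm]]] : exists q r, a = q * m.+1 + r /\ r < m.+1.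
  by exists (a %/ m.+1), (a %% m.+1); rewrite -divn_eq ltn_pmod.
have [r0|r_gt0] := posnP r.
  exists set0; last by exists q; rewrite big_set0 {1}ar r0 addn0.
  by rewrite cards0 -!setI_eq0 !set0I.
pose partner z := if z < r then r - z else m.+1 + r - z.
pose vF := [seq val x + 1 | x <- enum F].
(* The partner of [r] would be [m.+1], out of range; the two halves are where [z] could be its own
   partner; the rest would make [z] or its partner touched. *)
pose bad := r :: r./2 :: (r + m.+1)./2 :: vF ++ map partner vF.
pose cand := iota 1 (minn a.-1 m).
have size_vF : size vF = #|F| by rewrite size_map -cardE.
have /hasP[z] : has [predC bad] cand.
  rewrite has_predC; apply/negP => /allP sub.
  have := uniq_leq_size (iota_uniq _ _) sub.
  rewrite size_iota /bad /= size_cat size_map size_vF; lia.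
rewrite mem_iota /= !inE !negb_or mem_cat negb_or => z_rng.
case/and4P => zr zr2 zr3 /andP[zF zpF].
have inF x w : x \in F -> val x + 1 = w -> w \in vF.
  by move=> xF <-; apply: (map_f (fun x => val x + 1)); rewrite mem_enum.
have zm : z.-1 < m by lia.
have pm : (partner z).-1 < m by rewrite /partner; case: (ltnP z r); lia.
have ppz : partner (partner z) = z.
  by rewrite /partner; case: (ltnP z r) => ?; case: ltnP; lia.
pose x := Ordinal zm; pose y := Ordinal pm.
have xz : x.+1 = z by rewrite /=; lia.
have yz : y.+1 = partner z by rewrite /= /partner; case: (ltnP z r); lia.
have xF : x \notin F by apply: contra zF => xF; apply: inF xF _; rewrite addn1.
have yF : y \notin F.
  apply: contra zpF => yF; rewrite -ppz map_f //; apply: inF yF _.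
  by rewrite addn1; exact: yz.
have nxy : x != y.
  apply/eqP => xy; have: partner z = z by rewrite -yz -xy.
  by rewrite /partner; case: (ltnP z r); lia.
(* Mirror images sum to [m.+1], whereas [z + partner z] has the nonzero residue [r]. *)
have nxry : mirror x != y.
  apply/eqP => xy; have := addSrev x; rewrite xy yz xz /partner.
  by case: (ltnP z r); lia.
have xy_sum : \sum_(w in [set x; y]) w.+1 = z + partner z.
  by rewrite big_setU1 ?inE //= big_set1 yz xz.
exists [set x; y].
  split; first by rewrite cards2; case: (_ != _).
    by rewrite disjoints_subset; apply/subsetP => w; rewrite !inE => /orP[]/eqP->.
  rewrite imsetU1 imset_set1 disjoints_subset; apply/subsetP => w; rewrite !inE.
  have nfix v : v \notin F -> v != mirror v.
    by apply: contraNneq => e; apply: fixF.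
  case/orP => /eqP->; rewrite negb_or.
    by rewrite nfix //= -(inj_eq rev_ord_inj) rev_ordK.
  by rewrite nfix // eq_sym nxry.
(* If [q = 0] then [a = r], and [z < a] forces the small sum [r]; otherwise even the sum [m.+1 + r]
   fits into [a]. *)
case: (posnP q) => [q0|q_gt0].
  exists 0; rewrite xy_sum /partner {1}ar q0 mul0n; case: (ltnP z r); lia.
rewrite xy_sum /partner; case: (ltnP z r) => zr'.
  by exists q; rewrite {1}ar; lia.
exists q.-1; rewrite {1}ar -{1}(prednK q_gt0) mulSn; lia.
Qed.

(** No fixed point lies outside [F], so reflecting the larger halves onto the smaller ones turns
    each pair into a single term [m.+1], counted by its smaller member. *)
Lemma sum_mirror_pairs F (h : pred 'I_m) :
    (forall x, mirror x = x -> x \in F) -> (forall x, x \in F -> mirror x \in F) ->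
    (forall x, h (mirror x) = h x) ->
  \sum_(x | (x \notin F) && h x) x.+1 =
    #|[set x | (x \notin F) && (x < mirror x)] :&: [set x | h x]| * m.+1.
Proof.
move=> fixF symF hm.
have memF x : (mirror x \in F) = (x \in F).
  by apply/idP/idP => [xF|/symF //]; rewrite -(rev_ordK x) symF.
have nfix x : x \notin F -> (nat_of_ord x == mirror x) = false.
  by apply: contraNF => /eqP e; apply: fixF; apply/val_inj.
rewrite (bigID (fun x : 'I_m => x < mirror x)) /=.
rewrite [X in _ + X](reindex_inj (@rev_ord_inj m)).
rewrite [X in _ + X](eq_bigl (fun x => ((x \notin F) && h x) && (x < mirror x))).
  rewrite -big_split /= (eq_bigr (fun=> m.+1)); last by move=> x _; exact: addSrev.
  rewrite sum_nat_const; congr (_ * _); apply: eq_card => x.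
  by rewrite !inE unfold_in /= andbAC.
move=> x; rewrite -[m - _]/(val (mirror (mirror x))) memF hm rev_ordK.
case xF : (x \notin F) => //=.
by rewrite -leqNgt leq_eqVlt nfix.
Qed.

(** * Serving the targets one after another *)

Section Partial.
Variables (I : finType) (a : I -> nat).
Implicit Types (S : {set I}) (b : 'I_m -> option I).

(* [b x = Some i] when the number [x.+1] is given to the target [a i]; only
   numbers in [F] may be given. For targets in [S], what is still missing is a
   multiple of [m.+1], to be filled with pairs outside [F]. *)
Definition partial_assignment S F b :=
  [/\ forall x, mirror x = x -> x \in F,
      forall x, x \in F -> mirror x \in F,
      forall x, x \notin F -> b x = None,
      forall i, i \notin S -> forall x, b x != Some i
    & forall i, i \in S -> exists n,
        a i = \sum_(x | b x == Some i) x.+1 + n * m.+1].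

Definition pool F b := [set x in F | b x == None].

(** Target [i] first takes a set [J] of [t] pool elements, each at most [m], and [fresh_set]
    corrects the residue of the remainder by a set [E]. Then [F] gains [E] and its mirror image,
    while the pool loses [J] and gains at most the mirror image of [E]. *)
Lemma assign_next S F b i t : partial_assignment S F b -> i \notin S ->
    t <= #|pool F b| -> 2 * #|F| + 3 < m -> 2 * #|F| + 4 + t * m.+1 < a i ->
  exists F' b', [/\ partial_assignment (i |: S) F' b', #|F'| <= #|F| + 4
    & #|pool F' b'| <= #|pool F b| - t + 2].
Proof.
case=> fixF symF outF outS inS iS tQ Fm Fa.
have [J] : exists2 J : {set 'I_m}, J \subset pool F b & #|J| = t.
  have [s [us ss sizes]] : exists s : seq 'I_m, [/\ uniq s, {subset s <= pool F b} & size s = t].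
    exists (take t (enum (pool F b))); split; first by rewrite take_uniq ?enum_uniq.
      by move=> x /mem_take; rewrite mem_enum.
    by rewrite size_takel -?cardE.
  exists [set x in s]; first by apply/subsetP => x; rewrite inE => /ss.
  by rewrite cardsE (card_uniqP us).
move=> /subsetP JQ cardJ.
have sumJ : \sum_(x in J) x.+1 <= t * m.+1.
  by rewrite -cardJ -sum_nat_const leq_sum // => x _; rewrite ltnW // ltnS.
have [|E [cardE EF EE] [n an]] := @fresh_set F (a i - \sum_(x in J) x.+1) fixF Fm.
  lia.
have JF x : x \in J -> (x \in F) * (b x = None).
  by move/JQ; rewrite inE => /andP[-> /eqP->].
have EnF x : x \in E -> x \in F = false.
  by move=> xE; apply: (disjointFr EF xE).
have memF x : (mirror x \in F) = (x \in F).
  by apply/idP/idP => [xF|/symF //]; rewrite -(rev_ordK x) symF.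
have memmE x : (x \in mirror @: E) = (mirror x \in E).
  by rewrite -{1}(rev_ordK x) mem_imset //; exact: rev_ord_inj.
pose F' := F :|: (E :|: mirror @: E).
pose b' x := if x \in J :|: E then Some i else b x.
have b'i x : (b' x == Some i) = (x \in J :|: E).
  by rewrite /b'; case: ifP => // _; [rewrite eqxx | apply/negbTE/outS].
have b'j j x : j != i -> (b' x == Some j) = (b x == Some j).
  move=> ji; rewrite /b'; case: ifP => //; rewrite !inE => xJE.
  have -> : b x = None.
    case/orP: xJE => [/JF-> //|/EnF xF]; by rewrite outF ?xF.
  by apply/eqP => -[/esym/eqP]; rewrite (negPf ji).
have cardmE : #|mirror @: E| = #|E| by rewrite card_imset //; exact: rev_ord_inj.
exists F', b'; split; last 2 first.
- by rewrite /F' cardsU (cardsU E) cardmE; lia.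
- have sub : pool F' b' \subset (pool F b :\: J) :|: mirror @: E.
    apply/subsetP => x; rewrite !inE /b' !inE.
    case: (x \in J); case: (x \in E); rewrite ?andbF //=.
    by case: (x \in F); case: (x \in mirror @: E); rewrite //= ?orbT ?orbF.
  have JQ' : J \subset pool F b by apply/subsetP.
  have := subset_leq_card sub; rewrite cardsU cardsD (setIidPr JQ') cardmE cardJ.
  by lia.
split.
- by move=> x /fixF xF; rewrite inE xF.
- move=> x; rewrite !inE memF !memmE rev_ordK.
  by case: (x \in F); case: (x \in E); case: (mirror x \in E).
- move=> x; rewrite /b' !inE !negb_or => /and3P[xF xE _].
  rewrite (negPf xE) orbF; case: ifP => [/JF[]|_]; last exact: outF.
  by rewrite (negPf xF).
- move=> j; rewrite !inE negb_or => /andP[ji jS] x.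
  by rewrite b'j //; exact: outS.
move=> j; rewrite !inE; case: (eqVneq j i) => [-> _|ji /= jS].
  exists n; rewrite (eq_bigl (fun x => x \in J :|: E)); last exact: b'i.
  rewrite (big_setID J) /= setUK setDUl setDv set0U.
  have -> : E :\: J = E.
    apply/setDidPl; rewrite disjoint_subset; apply/subsetP => x xE.
    by rewrite inE; apply/negP => /JF[]; rewrite EnF.
  by rewrite -addnA -an subnKC // (leq_trans sumJ) //; lia.
have [n' an'] := inS _ jS; exists n'; rewrite an'; congr (_ + _).
by apply: eq_bigl => x; rewrite b'j.
Qed.

Lemma assign_rest s i0 S F b : partial_assignment S F b -> uniq (i0 :: s) ->
    (forall i, i \in i0 :: s -> i \notin S /\ 20 * m.+1 <= a i) ->
    2 * (#|F| + 4 * size s) <= m + 4 ->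
    (#|pool F b| + 4 * (size s).+1) * m.+1 <= a i0 + \sum_(i <- s) a i ->
  exists F' b', partial_assignment (S :|: [set i in s]) F' b' /\
    #|pool F' b'| * m.+1 <= a i0.
Proof.
elim: s S F b => [|i s IHs] S F b bP us sP Fm; rewrite ?big_nil ?big_cons => le_sum.
  exists F, b; rewrite set_nil setU0; split=> //; rewrite addn0 in le_sum.
  by apply: leq_trans le_sum; rewrite leq_mul2r leq_addr orbT.
have [iS ai] : i \notin S /\ 20 * m.+1 <= a i by apply: sP; rewrite !inE eqxx orbT.
set q := #|pool F b| in le_sum.
have Fm' : 2 * #|F| + 3 < m by move: Fm; rewrite [size _]/=; lia.
(* The subtracted 1 keeps one multiple of [m.+1] of the star free, enough room for its fresh
   numbers. *)
pose t := minn q (a i %/ m.+1).-1.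
have tq : t <= q by exact: geq_minl.
have ta : t.+1 * m.+1 <= a i.
  apply: leq_trans (leq_divM (a i) m.+1); rewrite leq_mul2r /=.
  have: 20 <= a i %/ m.+1 by rewrite leq_divRL.
  by have := geq_minr q (a i %/ m.+1).-1; rewrite -/t; lia.
have [|F' [b' [b'P F'F q'q]]] := assign_next bP iS tq Fm'; first by rewrite mulSn in ta; lia.
rewrite -/q in q'q.
have [| |||F'' [b'' [b''P leq'']]] := IHs _ _ _ b'P.
- by move: us; rewrite /= !inE !negb_or => /andP[/andP[_ ->] /andP[_ ->]].
- move=> j js; have [jS aj] : j \notin S /\ 20 * m.+1 <= a j.
    by apply: sP; move: js; rewrite !inE => /orP[->|->]; rewrite ?orbT.
  split=> //; rewrite !inE negb_or jS andbT; apply: contraTneq us => ji.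
  by move: js; rewrite ji /= !inE => /orP[/eqP->|->]; rewrite ?eqxx ?andbF.
- by move: Fm F'F; rewrite [size _]/=; move: (size s) #|F| #|F'| => z f f'; lia.
- have le_sums : 20 * m.+1 * (size s).+1 <= a i0 + \sum_(j <- s) a j.
    rewrite mulnS leq_add //; first by case: (sP i0); rewrite ?mem_head.
    rewrite -sum1_size big_distrr /= big_seq [leqRHS]big_seq leq_sum // => j js.
    by rewrite muln1; case: (sP j) => //; rewrite !inE js !orbT.
  (* If the old pool is used up, at most two elements are in the new one and the bound 20 per
     remaining star suffices. Otherwise [a i] is at most [t + 2] units while the pool shrinks by at
     least [t - 2], which preserves the invariant. *)
  have [qt|tlt] := eqVneq t q.
    apply: leq_trans le_sums; rewrite mulnAC leq_mul2r /=.
    by move: q'q; rewrite qt; move: (size s) #|pool F' b'| => z f; lia.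
  have te : t = (a i %/ m.+1).-1 by rewrite /t; rewrite /t in tlt; lia.
  have at2 : a i <= t.+2 * m.+1.
    rewrite te {1}(divn_eq (a i) m.+1); have := ltn_pmod (a i) (ltn0Sn m).
    have: 20 <= a i %/ m.+1 by rewrite leq_divRL.
    case: (a i %/ m.+1) => // d _; rewrite /= !mulSn; lia.
  rewrite -(leq_add2l (a i)) addnCA; apply: leq_trans le_sum.
  apply: leq_trans (leq_add at2 (leqnn _)) _.
  rewrite -mulnDl leq_mul2r [size (i :: s)]/=; apply/orP; right.
  by clearbody q t; move: (size s) #|pool F' b'| q'q => z f; lia.
exists F'', b''; split=> //; suff -> : S :|: [set j in i :: s] = i |: S :|: [set j in s] by [].
by apply/setP => j; rewrite !inE; case: (j == i); case: (j \in S).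
Qed.

(** Every other target needs a known number [d i] of untouched pairs. The pool, sent to [i0], fits
    into [a i0], so comparing totals shows that there are enough pairs; [i0] takes the surplus
    ones. *)
Lemma complete_assignment i0 F b : partial_assignment (~: [set i0]) F b ->
    #|pool F b| * m.+1 <= a i0 -> \sum_i a i = \sum_(x < m) x.+1 ->
  exists c : 'I_m -> I, forall i, \sum_(x | c x == i) x.+1 = a i.
Proof.
case=> fixF symF outF outS inS leq suma.
pose B i := \sum_(x | b x == Some i) x.+1.
pose d i := (a i - B i) %/ m.+1.
have aE i : i != i0 -> a i = B i + d i * m.+1.
  move=> ii0; have [|n an] := inS i; first by rewrite !inE.
  by rewrite /d an addKn mulnK.
pose P := [set x | (x \notin F) && (x < mirror x)].
have sumF : \sum_(x in F) x.+1 = \sum_(x in pool F b) x.+1 + \sum_(i | i != i0) B i.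
  rewrite (bigID (fun x => b x == None)) /=; congr (_ + _).
    by apply: eq_bigl => x; rewrite !inE.
  rewrite (partition_big (fun x => odflt i0 (b x)) (fun i => i != i0)) /=.
    apply: eq_bigr => i ii0; apply: eq_bigl => x.
    case bx: (b x) => [j|] /=; rewrite ?andbF ?andbT //=.
    by case xF: (x \in F) => //=; rewrite outF ?xF in bx.
  move=> x /andP[xF]; case bx: (b x) => [j|] //= _; apply/eqP => ji0.
  by have := outS i0; rewrite !inE eqxx => /(_ isT x); rewrite bx ji0 eqxx.
have sumT : \sum_(x < m) x.+1 = \sum_(x in F) x.+1 + #|P| * m.+1.
  rewrite (bigID (mem F)) /=; congr (_ + _).
  have := @sum_mirror_pairs F predT fixF symF (fun _ => erefl).
  under eq_bigl do rewrite andbT.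
  by move=> ->; congr (#|pred_of_set _| * _); apply/setP => x; rewrite !inE andbT.
have sumpool : \sum_(x in pool F b) x.+1 <= #|pool F b| * m.+1.
  by rewrite -sum_nat_const leq_sum // => x _; rewrite ltnW // ltnS.
have leD : \sum_(i | i != i0) d i <= #|P|.
  rewrite -(leq_pmul2r (ltn0Sn m)) big_distrl /=.
  move: suma (leq_trans sumpool leq).
  rewrite sumT sumF (bigD1 i0) //= (eq_bigr _ aE) big_split /=.
  move: (\sum_(i | i != i0) B i) (\sum_(i | i != i0) d i * m.+1).
  by move: (\sum_(x in pool F b) x.+1) (#|P| * m.+1) => ? ? ? ?; lia.
pose n i := if i == i0 then #|P| - \sum_(j | j != i0) d j else d i.
have sumn : \sum_i n i = #|P|.
  rewrite (bigD1 i0) //= [X in _ + X](eq_bigr d) /n ?eqxx ?subnK //.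
  by move=> i /negPf ->.
have [g gP] := split_card i0 sumn.
(* Both members of a pair share the representative [rep x], hence the same target. *)
pose rep x := if x < mirror x then x else mirror x.
have repm x : rep (mirror x) = rep x.
  by rewrite /rep rev_ordK; case: ltngtP => // /val_inj.
pose c x := if x \in F then odflt i0 (b x) else g (rep x).
have cP i : i != i0 -> \sum_(x | c x == i) x.+1 = a i.
  move=> ii0; rewrite (aE i ii0) (bigID (mem F)) /=; congr (_ + _).
    apply: eq_bigl => x; rewrite /c; case: ifP => xF; rewrite ?andbT ?andbF.
      by case: (b x) => [j|] //=; rewrite eq_sym (negPf ii0).
    by rewrite outF ?xF.
  have := @sum_mirror_pairs F (fun x => g (rep x) == i) fixF symF.
  rewrite (eq_bigl (fun x => (x \notin F) && (g (rep x) == i))).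
    move=> ->; last by move=> x; rewrite repm.
    have := gP i; rewrite /n (negPf ii0) => <-; congr (#|pred_of_set _| * _).
    by apply/setP => x; rewrite !inE /rep; case: (x < _); rewrite ?andbF ?andbT.
  by move=> x; rewrite andbC /c; case: (x \in F); rewrite ?andbF.
exists c => i; have [->|/cP //] := eqVneq i i0.
(* All other sums are correct, so equality of the totals forces the one at [i0]. *)
have := suma; rewrite (bigD1 i0) //= [RHS](partition_big c predT) //=.
by rewrite [RHS](bigD1 i0) //= [X in _ = _ + X](eq_bigr a) // => /addIn.
Qed.
End Partial.
End Symmetric.

(** * Partitioning the numbers 1 to m into prescribed sums *)

Lemma sum_ltn_double m : 2 * (\sum_(x < m) x.+1) = m * m.+1.
Proof. by elim: m => [|m IHm]; rewrite ?big_ord0 // big_ord_recr /= mulnDr IHm; lia. Qed.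

Lemma prescribed_sums m k (a : 'I_k -> nat) : 0 < m ->
    (forall i : 'I_k, minn (1600 * i.+1) (20 * m.+1) <= a i) ->
    \sum_i a i = \sum_(x < m) x.+1 ->
  exists c : 'I_m -> 'I_k, forall i, \sum_(x | c x == i) x.+1 = a i.
Proof.
move=> m_gt0 amin suma.
have dsuma : 2 * (\sum_i a i) = m * m.+1 by rewrite suma sum_ltn_double.
pose small n := [set i : 'I_k | (i < n) && (a i < 20 * m.+1)].
pose big := ~: small k.
have small0 : small 0 = set0 by apply/setP => i; rewrite !inE.
have smallS n (nk : n < k) : small n.+1 =
    if a (Ordinal nk) < 20 * m.+1 then Ordinal nk |: small n else small n.
  apply/setP => i; case: ifP => an; rewrite !inE ltnS leq_eqVlt.
    case: (i =P Ordinal nk) => [->|ni] //=; rewrite ?eqxx ?an //.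
    by case: eqP => // e; case: ni; apply/val_inj.
  by case: eqP => //= e; rewrite e ltnn /=; suff -> : i = Ordinal nk by []; apply/val_inj.
have notin_small n (nk : n < k) : Ordinal nk \notin small n by rewrite inE ltnn.
(* A small star at position [n] satisfies [1600 * n.+1 <= a < 20 * m.+1], hence [80 * n.+1 <= m]. *)
have card_small n : n <= k -> #|small n| <= n /\ 80 * #|small n| <= m.
  elim: n => [_|n IHn nk]; first by rewrite small0 cards0.
  have [len lem] := IHn (ltnW nk); rewrite (smallS n nk).
  case: ifP => an; last by split=> //; apply: leqW.
  rewrite cardsU1 notin_small add1n.
  have := amin (Ordinal nk); move: (a _) an => u an; rewrite geq_min [nat_of_ord _]/=.
  by move: #|small n| len lem => v; lia.
have [_ small80] := card_small k (leqnn k).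
have bigP i : i \in big -> 20 * m.+1 <= a i by rewrite !inE ltn_ord /= -leqNgt.
have big40 : 40 * #|big| <= m.
  rewrite -(leq_pmul2r (ltn0Sn m)) -dsuma (bigID (mem big)) /=.
  have : \sum_(i in big) 20 * m.+1 <= \sum_(i in big) a i by exact: leq_sum.
  by rewrite sum_nat_const; move: #|big| (\sum_(i in big) _) => u v; nia.
have sum_big : m * m.+1 <= 2 * \sum_(i in big) a i + 40 * #|small k| * m.+1.
  rewrite -dsuma (bigID (mem big)) /= mulnDr leq_add2l.
  have : \sum_(i in small k) a i <= \sum_(i in small k) 20 * m.+1.
    by apply: leq_sum => i; rewrite inE => /andP[_ /ltnW].
  rewrite sum_nat_const; under [X in _ -> 2 * X <= _]eq_bigl => i do rewrite in_setC negbK.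
  by move: #|small k| (\sum_(i in small k) _) => u v; nia.
(* There is at least one star; a small one gives [80 <= m], a big one [40 <= m]. *)
have m27 : 27 <= m.
  have := cardsC (small k); rewrite card_ord -/big => kE.
  have : 0 < k.
    rewrite lt0n; apply/eqP => k0; move: dsuma; rewrite big1; first by lia.
    by move=> i; have := ltn_ord i; rewrite {2}k0.
  by move: #|small k| #|big| small80 big40 kE => u v; lia.
(* Small stars take nothing from the pool. Initially only the fixed point of the mirror, if any, is
   touched; at position [n] at most [1 + 4 * n] numbers are, and
   [2 * (1 + 4 * n) + 4 < 1600 * n.+1]. *)
have greedy n : n <= k -> exists (F : {set 'I_m}) b, [/\ partial_assignment a (small n) F b,
    #|F| <= 1 + 4 * #|small n| & #|pool F b| <= 1 + 2 * #|small n|].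
  elim: n => [_|n IHn nk].
    exists [set x : 'I_m | rev_ord x == x], (fun=> None).
    rewrite small0.
    have F1 : #|[set x : 'I_m | rev_ord x == x]| <= 1.
      apply/card_le1_eqP => x y; rewrite !inE => /eqP fx /eqP fy; apply/val_inj => /=.
      by have := addSrev x; have := addSrev y; rewrite fx fy; lia.
    split; [split=> // x|by rewrite cards0|].
    - by move=> fx; rewrite inE fx.
    - by rewrite !inE rev_ordK eq_sym.
    - by rewrite inE.
    rewrite cards0; apply: leq_trans F1; apply/subset_leq_card/subsetP => x.
    by rewrite inE => /andP[].
  have [F [b [bP Fs Qs]]] := IHn (ltnW nk); have [len lem] := card_small n (ltnW nk).
  rewrite (smallS n nk); case: ifP => an; last by exists F, b.
  have [||F' [b' [b'P F's Q's]]] := assign_next bP (notin_small n nk) (leq0n _).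
  - by move: #|F| #|small n| Fs lem => u v; lia.
  - have := amin (Ordinal nk); move: (a _) an => w an; rewrite geq_min [nat_of_ord _]/=.
    by move: #|F| #|small n| Fs len => u v; lia.
  exists F', b'; split=> //; rewrite cardsU1 notin_small add1n.
    by move: #|F| #|F'| #|small n| F's Fs => u v w; lia.
  by move: #|pool F b| #|pool F' b'| #|small n| Q's Qs => u v w; lia.
have [F [b [bP Fs Qs]]] := greedy k (leqnn k).
have [big0|[i0 i0big]] := set_0Vmem big.
  move: sum_big; rewrite big0 big_set0; move: #|small k| small80 => u; nia.
pose s := enum (big :\ i0).
have size_s : (size s).+1 = #|big| by rewrite -cardE (cardsD1 i0 big) i0big.
have [|i|||F' [b' [b'P Q']]] := @assign_rest _ _ a s i0 _ _ _ bP.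
- by rewrite /= mem_enum !inE eqxx enum_uniq.
- rewrite inE mem_enum => ibig; have {}ibig : i \in big.
    by move: ibig; rewrite !inE => /orP[/eqP->|/andP[_ //]]; move: i0big; rewrite !inE.
  by split; [move: ibig; rewrite inE | exact: bigP].
- by move: (size s) #|F| #|small k| #|big| size_s Fs small80 big40 => u v w z; lia.
(* In units of [m.+1], the big stars total at least [m / 2 - 20 * #|small k|], which is at least
   [m / 4]; the need is at most [1 + 2 * #|small k| + 4 * #|big|], hence at most
   [1 + m / 40 + m / 10]. *)
- have -> : a i0 + \sum_(i <- s) a i = \sum_(i in big) a i.
    by rewrite [RHS](big_setD1 i0) //= big_enum.
  rewrite size_s; move: (\sum_(i in big) a i) #|pool F b| #|small k| #|big|
    sum_big Qs small80 big40.
  by move=> u v w z; nia.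
apply: complete_assignment Q' suma.
suff <- : small k :|: [set i in s] = ~: [set i0] by [].
apply/setP => i; rewrite in_setU [i \in [set _ in _]]inE mem_enum in_setD1 in_setC1 in_setC.
by have [->|_] := eqVneq i i0; [move: i0big; rewrite in_setC => /negPf-> | rewrite orbN].
Qed.

(** * From prescribed sums to the star decomposition *)

Section StarGraph.
Variables (T : finType) (c : T) (L : {set T}) (cL : c \notin L).

Lemma star_graph_edgeP (A : {set T}) : A \in [set [set c; x] | x in L] ->
  #|A| = 2 /\ A \subset c |: L.
Proof.
case/imsetP => x xL ->; split; last by rewrite setUS // sub1set.
by rewrite cards2; case: eqP => // cx; move: cL; rewrite cx xL.
Qed.

Definition star_graph := SGraph star_graph_edgeP.

Lemma star_edge_inj : {in L &, injective (fun x => [set c; x])}.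
Proof.
move=> x y xL yL /setP/(_ x); rewrite !inE eqxx orbT.
by case: eqP => [xc|_ /esym/eqP //]; move: cL; rewrite -xc xL.
Qed.

Lemma card_star_edges : #|[set [set c; x] | x in L]| = #|L|.
Proof. exact: card_in_imset star_edge_inj. Qed.

End StarGraph.

Theorem theorem1p4 (m : nat) (hm : 0 < m) (T : finType) (G : sgraph T)
    (k : nat) (St : 'I_k -> sgraph T)
    (hstar : forall i : 'I_k, is_star (St i))
    (hdisj : edge_disjoint St)
    (hunion : is_union G St)
    (hsize : nb_edges G = 'C(m.+1, 2))
    (hmin : forall i : 'I_k,
      minn (1600 * i.+1) (20 * m.+1) <= nb_edges (St i)) :
  exists H : 'I_m -> sgraph T, ascending_star_decomposition G H.
Proof.
have [ctr /fin_all_exists[L LP]] := fin_all_exists hstar.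
have [vG eG] := hunion.
have cardL i : nb_edges (St i) = #|L i|.
  by have [cL _ eS] := LP i; rewrite /nb_edges eS card_star_edges.
have sum_edges : \sum_i nb_edges (St i) = \sum_(x < m) x.+1.
  rewrite -[RHS](mulKn _ (isT : 0 < 2)) sum_ltn_double mulnC.
  rewrite divn2 -(bin2 m.+1) -hsize /nb_edges eG.
  by rewrite -sum1_card partition_disjoint_bigcup //=; apply: eq_bigr => i _; rewrite sum1_card.
have [c cP] := prescribed_sums hm hmin sum_edges.
(* Any set of leaves of a star spans a smaller star with the same centre, so the leaves of star [j]
   are split into parts of sizes [i.+1] over all [i] assigned to [j]. *)
have splitL j : exists g : T -> 'I_m,
    forall i, #|[set x in L j | g x == i]| = if c i == j then i.+1 else 0.
  by apply: split_card (Ordinal hm) _ _ _; rewrite -big_mkcond cP cardL.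
have [g gP] := fin_all_exists splitL.
pose D i := [set x in L (c i) | g (c i) x == i].
have DL i : D i \subset L (c i) by apply/subsetP => x; rewrite inE => /andP[].
have cD i : ctr (c i) \notin D i.
  by have [cL _ _] := LP (c i); apply: contra cL; apply/subsetP.
pose H i := star_graph (cD i).
have HS i : eset (H i) \subset eset (St (c i)).
  by have [_ _ ->] := LP (c i); exact: imsetS.
have eSG j : eset (St j) \subset eset G by rewrite eG; exact: (bigcup_sup j).
exists H; split.
- move=> i; split; last exact: subset_trans (HS i) (eSG _).
  have [_ vS _] := LP (c i); rewrite vG.
  apply: subset_trans (bigcup_sup (c i) _) => //; rewrite vS; exact: setUS.
- move=> i j nij; have [cij|ncij] := eqVneq (c i) (c j); last first.
    exact: disjointWl (HS i) (disjointWr (HS j) (hdisj _ _ ncij)).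
  rewrite -setI_eq0; apply/eqP/setP => e; rewrite !inE; apply/negP.
  case/andP => /imsetP[x + ->] /imsetP[y]; rewrite !inE -cij.
  move=> /andP[xL /eqP gx] /andP[yL /eqP gy] exy; have [cL _ _] := LP (c i).
  by case/eqP: nij; rewrite -gx -gy (star_edge_inj cL xL yL exy).
- apply/eqP; rewrite eqEsubset; apply/andP; split; last first.
    by apply/bigcupsP => i _; exact: subset_trans (HS i) (eSG _).
  rewrite eG; apply/bigcupsP => j _; have [_ _ ->] := LP j.
  apply/subsetP => _ /imsetP[x xL ->]; apply/bigcupP; exists (g j x) => //.
  (* Indices assigned to another star have an empty part in [L j], but this part contains [x]. *)
  have cg : c (g j x) = j.
    apply/eqP; have := gP j (g j x); case: eqP => // _ /eqP.
    by rewrite cards_eq0 => /eqP/setP/(_ x); rewrite !inE xL eqxx.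
  by rewrite /= cg; apply/imsetP; exists x; rewrite // inE cg xL eqxx.
move=> i; split; first by exists (ctr (c i)), (D i).
by rewrite /nb_edges /= card_star_edges ?cD // gP eqxx.
Qed.
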